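(* Let $(\Gamma,X,\mathcal{B})\in\mathcal{G}$, let $\mathcal{B}_0:=\mathcal{B}$ and $$\mathcal{B}_{i+1}:=\{\{\delta\in V(\Gamma)\mid Arc_1(\Gamma_{\mathcal{B}_i},\delta)=Arc_1(\Gamma_{\mathcal{B}_i},\sigma)\}\mid\sigma\in V(\Gamma)\}\qquad (i=0,1,\dots).$$ Then there exists a unique integer $m\ge1$ such that $$\mathcal{B}=\mathcal{B}_0>\mathcal{B}_1>\cdots>\mathcal{B}_m=\mathcal{B}_{m+1}=\cdots$$ is a chain of $X$-invariant partitions of $V(\Gamma)$. Let $p(\Gamma,X,\mathcal{B}_i)=(v_i,k_i,r_i,b_i,d_i)$ for $i=0,1,\dots$. Then the following hold: (1) $(\Gamma,X,\mathcal{B}_i)\in\mathcal{G}$, $v_i\ge2$ and $1\le k_i\le v_i-1$ for $i=0,1,\dots,m-1$. (2) $v_{i+1}\mid\gcd(v_i,k_i)$, $r_i\mid\gcd(r_{i+1},b_{i+1})$, $d_{i+1}\mid d_i$, $v_ir_i=b_ik_i$ and $r_id_i=val(\Gamma)$ for $i=0,\dots,m$. (3) $\Theta_{i+1}:=\{(Arc_1(\Gamma_{\mathcal{B}_i},\sigma),Arc_1(\Gamma_{\mathcal{B}_i},\tau))\mid\{\sigma,\tau\}\in E(\Gamma)\}$ is a self-paired $(X,1)$-rank-transitive orbit of $(r_i,1)$-double-stars of $\Gamma_{\mathcal{B}_i}$ such that $\Gamma_{\mathcal{B}_{i+1}}\cong\Pi(\Gamma_{\mathcal{B}_i},\Theta_{i+1})$,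 for $i=0,1,\dots,m-1$. (4) $(\Gamma_{\mathcal{B}_j},X,\mathcal{B}_i/\mathcal{B}_j)\in\mathcal{G}$ with parameters $p(\Gamma_{\mathcal{B}_j},X,\mathcal{B}_i/\mathcal{B}_j)=(v_i/v_j,\,k_i/v_j,\,r_i,\,b_i,\,b_j/r_i)$, and $(\Gamma_{\mathcal{B}_j})_{\mathcal{B}_i/\mathcal{B}_j}\cong\Gamma_{\mathcal{B}_i}$, for $0\le i<j\le m$. (5) Either of the following two cases occurs: (5.1) $v_m=k_m=1$, $\mathcal{B}_m$ is trivial and $\Gamma\cong\Pi(\Gamma_{\mathcal{B}_{m-1}},\Theta_m)$; or (5.2) $v_m=k_m\ge2$, and $\mathcal{B}_m$ is a nontrivial $X$-invariant partition of $V(\Gamma)$ such that $\Gamma$ is a multicover of $\Gamma_{\mathcal{B}_m}$.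
   Context: Graphs are finite, simple, undirected, with at least one edge. $X$ is a finite group. $val(\Gamma)$ is the valency of a regular graph $\Gamma$. Symmetric graphs. An arc of $\Gamma$ is an ordered pair of adjacent vertices. Let $X$ act on $V(\Gamma)$ preserving adjacency and non-adjacency. $\Gamma$ is $X$-symmetric if $X$ is transitive on $V(\Gamma)$ and on the arcs of $\Gamma$. $X_Y$ denotes the (set-wise) stabilizer of $Y$ in $X$. Partitions and quotients. A partition $\mathcal{B}$ of $V(\Gamma)$ is $X$-invariant if $B^x\in\mathcal{B}$ for all $B\in\mathcal{B}$, $x\in X$; it is nontrivial if some $B\in\mathcal{B}$ has $1<|B|<|V(\Gamma)|$, and trivial otherwise. The quotient graph $\Gamma_{\mathcal{B}}$ has vertex set $\mathcal{B}$, two distinct blocks being adjacent iff there is at least one edge of $\Gamma$ between them; $X$ acts on it by permuting blocks. It is always assumed that $\Gamma_{\mathcal{B}}$ has at least one edge. For an $X$-symmetric graph $\Gamma$ and $X$-invariant partition $\mathcal{B}$, let $\Gamma_{\mathcal{B}}(\sigma)$ be the set of blocks containing at least one neighbour of the vertex $\sigma$, and let $\Gamma(B)$ be the set of vertices with at least one neighbour in $B$. For adjacent blocks $B,C$ put $v=|B|$, $k=|B\cap\Gamma(C)|$, $r=|\Gamma_{\mathcal{B}}(\sigma)|$, $b=$ the valency of $\Gamma_{\mathcal{B}}$, and $d=$ the valency of the bipartite subgraph of $\Gamma$ induced by $(B\cap\Gamma(C))\cup(C\cap\Gamma(B))$; these do not depend on choices and $p(\Gamma,X,\mathcal{B}):=(v,k,r,b,d)$.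 For $\mathcal{B}$ nontrivial, either $v=k\ge2$ and $r=b\ge1$ ($\Gamma$ is a multicover of $\Gamma_{\mathcal{B}}$), or $v>k\ge1$ and $b>r\ge1$ ($\Gamma$ is not a multicover of $\Gamma_{\mathcal{B}}$). $\mathcal{G}$ is the set of triples $(\Gamma,X,\mathcal{B})$ such that $\Gamma$ is a finite $X$-symmetric graph, $\mathcal{B}$ is a nontrivial $X$-invariant partition of $V(\Gamma)$ and $\Gamma$ is not a multicover of $\Gamma_{\mathcal{B}}$. Refinements. For $X$-invariant partitions, $\mathcal{B}\ge\mathcal{B}'$ means that every block of $\mathcal{B}'$ is contained in a block of $\mathcal{B}$; $\mathcal{B}>\mathcal{B}'$ means $\mathcal{B}\ge\mathcal{B}'$ and $\mathcal{B}\ne\mathcal{B}'$. If $\mathcal{B}\ge\mathcal{B}'$, then $\mathcal{B}/\mathcal{B}':=\{\{B'\in\mathcal{B}'\mid B'\subseteq B\}\mid B\in\mathcal{B}\}$, a partition of $V(\Gamma_{\mathcal{B}'})$. $Arc_1(\Gamma_{\mathcal{B}},\sigma):=\{(B(\sigma),C)\mid C\in\Gamma_{\mathcal{B}}(\sigma)\}$, where $B(\sigma)$ is the block of $\mathcal{B}$ containing $\sigma$. Stars (case $l=1$). For an $X$-symmetric graph $\Sigma$ and $\tilde r\ge 1$, an $(\tilde r,1)$-star of $\Sigma$ is a set of $\tilde r$ arcs of $\Sigma$ all starting at the same vertex, called its center. An $(\tilde r,1)$-double-star is a pair $(S,T)$ of $(\tilde r,1)$-stars with centers $\sigma,\tau$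 such that $(\sigma,\tau)\in S$ and $(\tau,\sigma)\in T$. A set $\Theta$ of double-stars is self-paired if $(S,T)\in\Theta$ implies $(T,S)\in\Theta$. Put $V(\Theta)=\{S,T\mid(S,T)\in\Theta\}$ and $E(\Theta)=\{\{S,T\}\mid(S,T)\in\Theta\}$. $\Theta$ is $(X,1)$-rank-transitive if $X$ is transitive on both $\Theta$ and $V(\Theta)$ and $X_S$ is transitive on $S$ for each $S\in V(\Theta)$. The double-star graph $\Pi(\Sigma,\Theta)$ (defined for $\Theta$ self-paired and $(X,1)$-rank-transitive, with $\Sigma$ of valency $\tilde b\ge2$ and $\tilde r\le\tilde b-1$) has vertex set $V(\Theta)$ and edge set $E(\Theta)$. *)

(* Defs.v *)
From mathcomp Require Import all_boot all_fingroup.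

Set Implicit Arguments.
Unset Strict Implicit.
Unset Printing Implicit Defensive.

(* A graph carries its own vertex set inside a finite type, so that a quotient
   graph of a graph on T is a graph on {set T}, and a quotient of a quotient is
   a graph on {set {set T}}. *)
Record graph (T : finType) := Graph {
  vset : {set T};
  adj : rel T;
  adj_irr : irreflexive adj;
  adj_sym : symmetric adj;
  adj_vset : forall x y, adj x y -> x \in vset
}.

Section Graphs.
Variable T : finType.
Implicit Types (G : graph T) (P : {set {set T}}).

Definition arcs G : {set T * T} := [set a | adj G a.1 a.2].

Definition has_edge G : Prop := exists x y, adj G x y.

Definition has_valency G (n : nat) : Prop :=
  forall x, x \in vset G -> #|[set y | adj G x y]| = n.

Fact induced_irr G (A : {set T}) :
  irreflexive [rel x y | [&& x \in A, y \in A & adj G x y]].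
Proof. by move=> x /=; rewrite adj_irr !andbF. Qed.

Fact induced_sym G (A : {set T}) :
  symmetric [rel x y | [&& x \in A, y \in A & adj G x y]].
Proof. by move=> x y /=; rewrite adj_sym andbCA. Qed.

Fact induced_vset G (A : {set T}) x y :
  [rel x y | [&& x \in A, y \in A & adj G x y]] x y -> x \in vset G :&: A.
Proof. by case/and3P=> xA _ xy; rewrite inE xA (adj_vset xy). Qed.

Definition induced G (A : {set T}) : graph T :=
  Graph (@induced_irr G A) (@induced_sym G A) (@induced_vset G A).

Definition quot_adj G P : rel {set T} :=
  [rel B C | [&& B \in P, C \in P, B != C
               & [exists x in B, exists y in C, adj G x y]]].

Fact quot_irr G P : irreflexive (quot_adj G P).
Proof. by move=> B; rewrite /quot_adj /= eqxx !andbF. Qed.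

Fact quot_sym G P : symmetric (quot_adj G P).
Proof.
move=> B C; rewrite /quot_adj /= andbCA eq_sym; do 3!congr (_ && _).
by apply/exists_inP/exists_inP=> -[x xB /exists_inP[y yC xy]];
  exists y => //; apply/exists_inP; exists x; rewrite // adj_sym.
Qed.

Fact quot_vset G P B C : quot_adj G P B C -> B \in P.
Proof. by case/and4P. Qed.

Definition quot G P : graph {set T} :=
  Graph (@quot_irr G P) (@quot_sym G P) (@quot_vset G P).

End Graphs.

Section Partitions.
Variable T : finType.
Implicit Types (G : graph T) (P : {set {set T}}).

Definition adj_blocks G P (x : T) : {set {set T}} :=
  [set C in P | [exists y in C, adj G x y]].

Definition nbr_set G (B : {set T}) : {set T} :=
  [set x | [exists y in B, adj G x y]].

(* p(G, X, P) = (v, k, r, b, d): the values are required to be the same for all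
   choices of blocks and vertices, and P to have at least one pair of adjacent
   blocks, so that (v, k, r, b, d) is determined by G and P. *)
Definition has_params G P (v k r b d : nat) : Prop :=
  [/\ has_edge (quot G P),
      forall B C, adj (quot G P) B C ->
        [/\ #|B| = v,
            #|B :&: nbr_set G C| = k
          & has_valency
              (induced G ((B :&: nbr_set G C) :|: (C :&: nbr_set G B))) d],
      forall x, x \in vset G -> #|adj_blocks G P x| = r
    & has_valency (quot G P) b].

Definition multicover G P : Prop :=
  exists v k r b d, has_params G P v k r b d /\
    [/\ v = k, 2 <= k, r = b & 1 <= b].

Definition nontrivial_partition G P : Prop :=
  exists2 B, B \in P & 1 < #|B| < #|vset G|.

Definition coarsens P P' : Prop :=
  forall B', B' \in P' -> exists2 B, B \in P & B' \subset B.

Definition strictly_coarsens P P' : Prop := coarsens P P' /\ P <> P'.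

Definition quot_partition P P' : {set {set {set T}}} :=
  [set [set B' in P' | B' \subset B] | B : {set T} in P].

Definition arc1 G P (x : T) : {set {set T} * {set T}} :=
  [set (pblock P x, C) | C in adj_blocks G P x].

Definition next_partition G P : {set {set T}} :=
  [set [set y in vset G | arc1 G P y == arc1 G P x] | x in vset G].

Definition partition_seq G P (i : nat) : {set {set T}} :=
  iter i (next_partition G) P.

Definition arc1_pairs G P :
    {set {set {set T} * {set T}} * {set {set T} * {set T}}} :=
  [set (arc1 G P a.1, arc1 G P a.2) | a in arcs G].

End Partitions.

Definition graph_iso (T1 T2 : finType) (G1 : graph T1) (G2 : graph T2) : Prop :=
  exists f : T1 -> T2,
    [/\ {in vset G1 &, injective f},
        f @: vset G1 = vset G2
      & {in vset G1 &, forall x y, adj G2 (f x) (f y) = adj G1 x y}].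

Section PairAction.
Variables (gT : finGroupType) (T : finType) (to : {action gT &-> T}).

Definition pair_act (p : T * T) (x : gT) : T * T := (to p.1 x, to p.2 x).

Fact pair_act1 : pair_act^~ 1%g =1 id.
Proof. by case=> a b; rewrite /pair_act !act1. Qed.

Fact pair_actM p : act_morph pair_act p.
Proof. by move=> x y; rewrite /pair_act /= !actM. Qed.

Canonical pair_action : {action gT &-> T * T} :=
  TotalAction pair_act1 pair_actM.

End PairAction.

Section SymmetricGraphs.
Variables (gT : finGroupType) (T : finType).
Variables (to : {action gT &-> T}) (X : {group gT}).
Implicit Types (G : graph T) (P : {set {set T}}).

(* Only the action of X on vset G matters. *)
Definition X_symmetric G : Prop :=
  [/\ has_edge G,
      [acts X, on vset G | to],
      forall x, x \in X ->
        {in vset G &, forall a b, adj G (to a x) (to b x) = adj G a b},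
      [transitive X, on vset G | to]
    & [transitive X, on arcs G | pair_action to]].

Definition invariant_partition G P : Prop :=
  partition P (vset G) /\ [acts X, on P | to^*].

Definition in_calG G P : Prop :=
  [/\ X_symmetric G,
      invariant_partition G P /\ has_edge (quot G P),
      nontrivial_partition G P
    & ~ multicover G P].

Definition refinement_chain G P (m : nat) : Prop :=
  [/\ 1 <= m,
      forall i, invariant_partition G (partition_seq G P i),
      forall i, i < m ->
        strictly_coarsens (partition_seq G P i) (partition_seq G P i.+1)
    & forall i, m <= i -> partition_seq G P i = partition_seq G P i.+1].

End SymmetricGraphs.

Section DoubleStars.
Variable T : finType.
Implicit Types (Sg : graph T) (S : {set T * T}).
Implicit Type Th : {set {set T * T} * {set T * T}}.

Definition star_at Sg (r : nat) (c : T) S : Prop :=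
  [/\ 1 <= r, #|S| = r, S \subset arcs Sg & forall a, a \in S -> a.1 = c].

Definition double_star Sg (r : nat) (p : {set T * T} * {set T * T}) : Prop :=
  exists c1 c2, [/\ star_at Sg r c1 p.1, star_at Sg r c2 p.2,
                    (c1, c2) \in p.1 & (c2, c1) \in p.2].

Definition self_paired Th : Prop :=
  forall p, p \in Th -> (p.2, p.1) \in Th.

Definition star_vset Th : {set {set T * T}} :=
  [set p.1 | p in Th] :|: [set p.2 | p in Th].

Definition star_eset Th : {set {set {set T * T}}} :=
  [set [set p.1; p.2] | p in Th].

Definition rank_transitive (gT : finGroupType) (to : {action gT &-> T})
    (X : {group gT}) Th : Prop :=
  [/\ [transitive X, on Th | pair_action (pair_action to)^*],
      [transitive X, on star_vset Th | (pair_action to)^*]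
    & forall S, S \in star_vset Th ->
        [transitive 'N_X(S | pair_action to), on S | pair_action to]].

Definition dsg_adj Th : rel {set T * T} :=
  [rel S1 S2 | (S1 != S2) && ([set S1; S2] \in star_eset Th)].

Fact dsg_irr Th : irreflexive (dsg_adj Th).
Proof. by move=> S; rewrite /dsg_adj /= eqxx. Qed.

Fact dsg_sym Th : symmetric (dsg_adj Th).
Proof. by move=> S1 S2; rewrite /dsg_adj /= eq_sym setUC. Qed.

Fact dsg_vset Th S1 S2 : dsg_adj Th S1 S2 -> S1 \in star_vset Th.
Proof.
case/andP=> _ /imsetP[p pTh eqp].
have: S1 \in [set p.1; p.2] by rewrite -eqp set21.
by case/set2P=> ->; rewrite inE imset_f ?orbT.
Qed.

(* The double-star graph Pi(Sg, Th); it depends on Sg only through Th. *)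
Definition double_star_graph Th : graph {set T * T} :=
  Graph (@dsg_irr Th) (@dsg_sym Th) (@dsg_vset Th).

(* The conditions on Sg and r under which Pi(Sg, Th) is defined for a
   self-paired, rank-transitive set Th of (r,1)-double-stars of Sg. *)
Definition star_base (gT : finGroupType) (to : {action gT &-> T})
    (X : {group gT}) Sg (r : nat) : Prop :=
  X_symmetric to X Sg /\
  exists b, [/\ has_valency Sg b, 2 <= b & r <= b.-1].

End DoubleStars.

(* Main.v *)
Require Import Defs.
From mathcomp Require Import all_boot all_fingroup.

Set Implicit Arguments.
Unset Strict Implicit.
Unset Printing Implicit Defensive.

(** Arc-transitivity makes everything that can be counted at an arc constant, so
the five parameters exist for every invariant partition whose quotient has an
edge ([params_at]), and two double counts give v r = b k and val(G) = r d
([count_vr_bk], [valency_rd]).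

The next partition splits each block according to which blocks its vertices see.
It is stationary exactly when the vertices of a block all see the same blocks,
that is, when k = v ([next_fixP]); for a nontrivial partition this is the
multicover condition ([multicover_vk]). As long as it is not stationary, the
block size drops strictly: B :&: Gamma(C) is a union of blocks of every later
partition, so a later block has at most k < v vertices. This is why the chain
strictly descends, and then stops, at a first index m, where v = k. Case (5)
is then the alternative between one-vertex blocks and larger ones.

All the rest compares two partitions P and Q such that vertices in the same block
of Q have the same stars with respect to P; this holds for any two terms B_i, B_j
of the chain with i < j ([seq_refines]). Then
- being in a given block of P, and seeing a given block of P, are properties of
  the blocks of Q. Hence the quotient of the graph by Q, with the partition that
  P induces on it, has the parameters v_P/v_Q and k_P/v_Q and the same r and b
  ([refine_v], [refine_k], [refine_r], [refine_b]);
- this quotient is a symmetric graph of valency b_Q with an invariant partition,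
  so the identity val = r d applies to it as well and says b_Q = r_P d', which
  determines its last parameter and shows that r_P divides b_Q ([refine_d]);
- the neighbours of a vertex in a block of P fall into classes of size d_Q
  according to their block of Q, so d_Q divides d_P ([dvd_d]), and
  r_P d_P = r_Q d_Q = val(G) then yields r_P | r_Q ([dvd_r]).

A block of the next partition is the set of vertices with a given star, so the
blocks correspond to the stars, and adjacent blocks to the double-stars that come
from the arcs of G ([next_iso]). Transitivity of X on these objects is inherited
from G; for the stabilizer of a star this uses an element that fixes the vertex x
and moves one neighbour of x to another ([arc1_rank_transitive]). *)

(** * Counting and partitions *)

(** The source of the divisibilities between parameters; f will be the map that
sends a vertex to its block. *)
Lemma card_fibers (T T' : finType) (f : T -> T') (A : {set T}) n :
  (forall y, y \in A -> #|[set x in A | f x == f y]| = n) ->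
  #|A| = #|f @: A| * n.
Proof.
move=> fibn; rewrite -sum1_card (partition_big_imset f) /= -sum_nat_const.
apply: eq_bigr => _ /imsetP[y yA ->]; rewrite -(fibn y yA) -sum1_card.
by apply: eq_bigl => x; rewrite inE.
Qed.

Section PartitionBlocks.
Variables (T : finType) (A : {set T}) (P : {set {set T}}).
Hypothesis partP : partition P A.

Lemma part_pblock_mem x : x \in A -> pblock P x \in P.
Proof. by move=> xA; rewrite pblock_mem ?(cover_partition partP). Qed.

Lemma part_mem_pblock x : (x \in pblock P x) = (x \in A).
Proof. by rewrite mem_pblock (cover_partition partP). Qed.

Lemma part_def_pblock B x : B \in P -> x \in B -> pblock P x = B.
Proof. by move=> BP xB; rewrite (def_pblock (partition_trivIset partP) BP). Qed.

Lemma part_block_sub B x : B \in P -> x \in B -> x \in A.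
Proof. by move=> BP xB; rewrite -part_mem_pblock (part_def_pblock BP). Qed.

Lemma part_blockP B : B \in P -> exists2 x, x \in A & B = pblock P x.
Proof.
move=> BP; have /set0Pn[x xB]: B != set0 := partition_neq0 partP BP.
by exists x; [exact: part_block_sub BP xB | rewrite (part_def_pblock BP)].
Qed.

Lemma part_pblockE x y :
  x \in A -> (y \in pblock P x) = (y \in A) && (pblock P y == pblock P x).
Proof.
move=> xA; apply/idP/andP => [yx | [yA /eqP<-]]; last by rewrite part_mem_pblock.
have xP := part_pblock_mem xA.
by rewrite (part_def_pblock xP yx) (part_block_sub xP yx).
Qed.

End PartitionBlocks.

Lemma part_eq (T : finType) (A : {set T}) (P Q : {set {set T}}) :
    partition P A -> partition Q A -> {in A, pblock P =1 pblock Q} -> P = Q.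
Proof.
move=> partP partQ eqPQ; apply/setP=> B; apply/idP/idP => BP.
  have [x xA ->] := part_blockP partP BP.
  by rewrite eqPQ // (part_pblock_mem partQ).
have [x xA ->] := part_blockP partQ BP.
by rewrite -eqPQ // (part_pblock_mem partP).
Qed.

Lemma coarsensP (T : finType) (A : {set T}) (P Q : {set {set T}}) :
    partition P A -> partition Q A ->
  (coarsens P Q <->
   {in A &, forall x y, pblock Q x = pblock Q y -> pblock P x = pblock P y}).
Proof.
move=> partP partQ; split=> [PQ x y xA yA eqQ | PQ _ /(part_blockP partQ)[x xA ->]].
  have [B BP /subsetP subB] := PQ _ (part_pblock_mem partQ xA).
  rewrite !(part_def_pblock partP BP) //; apply: subB.
    by rewrite eqQ (part_mem_pblock partQ).
  by rewrite (part_mem_pblock partQ).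
exists (pblock P x); first exact: (part_pblock_mem partP).
apply/subsetP=> y; rewrite (part_pblockE partQ _ xA) => /andP[yA /eqP yx].
by rewrite (part_pblockE partP _ xA) yA (PQ _ _ yA xA yx) eqxx.
Qed.

(** * Symmetric graphs *)

Lemma transitive_on (gT : finGroupType) (T : finType) (to : {action gT &-> T})
    (X : {group gT}) (S : {set T}) x0 :
    x0 \in S -> (forall x g, g \in X -> x \in S -> to x g \in S) ->
    (forall x y, x \in S -> y \in S -> exists2 g, g \in X & y = to x g) ->
  [transitive X, on S | to].
Proof.
move=> x0S stabS linkS; apply/imsetP; exists x0 => //.
apply/setP=> y; apply/idP/orbitP => [yS | [g gX <-]]; last exact: stabS.
by have [g gX ->] := linkS _ _ x0S yS; exists g.
Qed.

Lemma acts_on (gT : finGroupType) (T : finType) (to : {action gT &-> T})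
    (X : {group gT}) (S : {set T}) :
    (forall x g, g \in X -> x \in S -> to x g \in S) -> [acts X, on S | to].
Proof.
move=> stabS; apply/actsP => g gX x; apply/idP/idP; last exact: stabS.
by move=> xgS; rewrite -(actK to g x) stabS ?groupV.
Qed.

Lemma valency_uniq (T : finType) (G : graph T) n n' x :
  x \in vset G -> has_valency G n -> has_valency G n' -> n = n'.
Proof. by move=> xV /(_ x xV)<- /(_ x xV). Qed.

Section Symmetric.
Variables (gT : finGroupType) (T : finType) (to : {action gT &-> T}).
Variables (X : {group gT}) (G : graph T).
Hypothesis symG : X_symmetric to X G.

Lemma adj_vsetr x y : adj G x y -> y \in vset G.
Proof. by rewrite adj_sym => /adj_vset. Qed.

Lemma sym_mem g x : g \in X -> (to x g \in vset G) = (x \in vset G).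
Proof. by case: symG => _ /acts_act aX _ _ _ gX; apply: aX. Qed.

Lemma sym_adj g x y : g \in X -> adj G (to x g) (to y g) = adj G x y.
Proof.
move=> gX; case: symG => _ _ adjX _ _.
apply/idP/idP => xy; last by rewrite adjX // ?(adj_vset xy) ?(adj_vsetr xy).
have := adj_vset xy; have := adj_vsetr xy; rewrite !sym_mem // => yV xV.
by rewrite -(adjX g).
Qed.

Lemma sym_vertex x y :
  x \in vset G -> y \in vset G -> exists2 g, g \in X & y = to x g.
Proof. by case: symG => _ _ _ trX _; apply: (atransP2 trX). Qed.

Lemma sym_arc x y x' y' : adj G x y -> adj G x' y' ->
  exists g, [/\ g \in X, x' = to x g & y' = to y g].
Proof.
case: symG => _ _ _ _ trX xy xy'.
have [] := atransP2 trX (_ : (x, y) \in _) (_ : (x', y') \in _); rewrite ?inE //.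
by move=> g gX [-> ->]; exists g.
Qed.

Lemma sym_nbr x : x \in vset G -> exists y, adj G x y.
Proof.
case: symG => -[a [b ab]] _ _ _ _ xV.
have [g gX ->] := sym_vertex (adj_vset ab) xV.
by exists (to b g); rewrite sym_adj.
Qed.

(** The five parameters are independent of choices because each of them counts
a set attached equivariantly to an arc, and the group is transitive on arcs. *)
Lemma arc_card (U : finType) (toU : {action gT &-> U}) (F : T -> T -> {set U}) :
    (forall g x y u, g \in X -> adj G x y -> u \in F x y ->
       toU u g \in F (to x g) (to y g)) ->
  forall x y x' y', adj G x y -> adj G x' y' -> #|F x y| = #|F x' y'|.
Proof.
move=> FX; have leF x y x' y' : adj G x y -> adj G x' y' -> #|F x y| <= #|F x' y'|.
  move=> xy xy'; have [g [gX -> ->]] := sym_arc xy xy'.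
  rewrite -(card_setact toU (F x y) g) subset_leq_card //.
  by apply/subsetP => _ /imsetP[u uF ->]; apply: FX.
by move=> x y x' y' xy xy'; apply/eqP; rewrite eqn_leq !leF.
Qed.

End Symmetric.

(** * Block systems and their parameters *)

Section Blocks.
Variables (gT : finGroupType) (T : finType) (to : {action gT &-> T}).
Variables (X : {group gT}) (G : graph T) (P : {set {set T}}).
Hypothesis symG : X_symmetric to X G.
Hypothesis invP : invariant_partition to X G P.
Hypothesis edgeP : has_edge (quot G P).

Let partP : partition P (vset G) := invP.1.

Lemma block_act g B : g \in X -> (to^*%act B g \in P) = (B \in P).
Proof. by case: invP => _ /acts_act aX gX; apply: aX. Qed.

Lemma pblock_act g x : g \in X -> x \in vset G ->
  pblock P (to x g) = to^*%act (pblock P x) g.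
Proof.
move=> gX xV; apply: (part_def_pblock partP).
  by rewrite block_act // (part_pblock_mem partP).
by apply: mem_setact; rewrite (part_mem_pblock partP).
Qed.

Lemma mem_pblock_act g x y : g \in X -> x \in vset G ->
  y \in pblock P x -> to y g \in pblock P (to x g).
Proof. by move=> gX xV yx; rewrite pblock_act // mem_setact. Qed.

(** An arc inside a block would, by arc-transitivity, force every arc to lie inside
a block, and the quotient would have no edge. *)
Lemma adj_cross x y : adj G x y -> pblock P x != pblock P y.
Proof.
case: edgeP => B [C /and4P[BP CP nBC /exists_inP[a aB /exists_inP[b bC ab]]]] xy.
have [g [gX -> ->]] := sym_arc symG ab xy.
rewrite !pblock_act ?(adj_vset ab) ?(adj_vsetr ab) //.
rewrite (part_def_pblock partP BP) // (part_def_pblock partP CP) //.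
by apply: contraNneq nBC => /(act_inj to^*) ->.
Qed.

Lemma quot_adjP B C :
  reflect (exists x y, [/\ adj G x y, B = pblock P x & C = pblock P y])
          (adj (quot G P) B C).
Proof.
apply: (iffP and4P).
  case=> BP CP _ /exists_inP[a aB /exists_inP[b bC ab]]; exists a, b.
  by rewrite (part_def_pblock partP BP) // (part_def_pblock partP CP).
case=> x [y [xy -> ->]]; have [xV yV] := (adj_vset xy, adj_vsetr xy).
rewrite !(part_pblock_mem partP) // adj_cross //; split=> //.
apply/exists_inP; exists x; rewrite ?(part_mem_pblock partP) //.
by apply/exists_inP; exists y; rewrite ?(part_mem_pblock partP).
Qed.

Lemma quot_adj_pblock x y : adj G x y -> adj (quot G P) (pblock P x) (pblock P y).
Proof. by move=> xy; apply/quot_adjP; exists x, y. Qed.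

Lemma adj_blocksE x : adj_blocks G P x = pblock P @: [set y | adj G x y].
Proof.
apply/setP=> C; apply/setIdP/imsetP => [[CP /exists_inP[y yC xy]] | [y + ->]].
  by exists y; rewrite ?inE // (part_def_pblock partP CP).
rewrite inE => xy; rewrite (part_pblock_mem partP) ?(adj_vsetr xy) //.
split=> //; apply/exists_inP; exists y => //.
by rewrite (part_mem_pblock partP) (adj_vsetr xy).
Qed.

Lemma mem_adj_blocks x y : adj G x y -> pblock P y \in adj_blocks G P x.
Proof. by move=> xy; rewrite adj_blocksE imset_f ?inE. Qed.

Lemma adj_blocks_quot x C : C \in adj_blocks G P x -> adj (quot G P) (pblock P x) C.
Proof.
by rewrite adj_blocksE => /imsetP[y + ->]; rewrite inE; apply: quot_adj_pblock.
Qed.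

Lemma adj_blocks_act g x : g \in X ->
  adj_blocks G P (to x g) = to^*^*%act (adj_blocks G P x) g.
Proof.
move=> gX; rewrite !adj_blocksE; apply/setP=> C.
apply/imsetP/imsetP => [[y + ->] | [_ /imsetP[y + ->] ->]]; rewrite inE => xy.
  have xyV : adj G x (to y g^-1%g) by rewrite -(sym_adj symG _ _ gX) actKV.
  exists (pblock P (to y g^-1%g)); first by rewrite imset_f ?inE.
  by rewrite -pblock_act ?(adj_vsetr xyV) // actKV.
exists (to y g); first by rewrite inE (sym_adj symG).
by rewrite -pblock_act ?(adj_vsetr xy).
Qed.

Lemma quot_sym : X_symmetric to^* X (quot G P).
Proof.
have qadj g B C : g \in X -> adj (quot G P) B C ->
    adj (quot G P) (to^*%act B g) (to^*%act C g).
  move=> gX /quot_adjP[x [y [xy -> ->]]].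
  rewrite -!pblock_act ?(adj_vset xy) ?(adj_vsetr xy) //.
  by apply: quot_adj_pblock; rewrite (sym_adj symG).
case: edgeP => B0 [C0 BC0]; split=> //.
- by case: invP.
- move=> g gX B C _ _; apply/idP/idP; last exact: qadj.
  by move/(qadj _ _ _ (groupVr gX)); rewrite !actK.
- apply: (@transitive_on _ _ _ _ _ B0); first exact: adj_vset BC0.
    by move=> B g gX; rewrite /= block_act.
  move=> _ _ /(part_blockP partP)[x xV ->] /(part_blockP partP)[y yV ->].
  have [g gX ->] := sym_vertex symG xV yV.
  by exists g => //; rewrite pblock_act.
apply: (@transitive_on _ _ _ _ _ (B0, C0)); first by rewrite inE.
  by move=> [B C] g gX; rewrite !inE /=; apply: qadj.
move=> [B C] [B' C']; rewrite !inE.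
rewrite /= => /quot_adjP[x [y [xy -> ->]]] /quot_adjP[x' [y' [xy' -> ->]]].
have [g [gX -> ->]] := sym_arc symG xy xy'; exists g => //.
by rewrite /= /pair_act /= -!pblock_act ?(adj_vset xy) ?(adj_vsetr xy).
Qed.

(** The parameters are read off at one arc, so that they become functions of the
partition; [params_at] shows that the choice of the arc is immaterial. *)
Definition par_v (a : T) := #|pblock P a|.
Definition par_k (a b : T) := #|pblock P a :&: nbr_set G (pblock P b)|.
Definition par_r (a : T) := #|adj_blocks G P a|.
Definition par_b (a : T) := #|[set C | adj (quot G P) (pblock P a) C]|.
Definition par_d (a b : T) := #|[set y in pblock P b | adj G a y]|.

Lemma par_d_arc a b x y : adj G a b -> adj G x y -> par_d x y = par_d a b.
Proof.
move=> ab xy; apply: (arc_card symG (toU := to)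
  (F := fun a b => [set y in pblock P b | adj G a y])) => // g {}x {}y u gX {}xy.
rewrite !inE (sym_adj symG) // => /andP[uy ->].
by rewrite mem_pblock_act ?(adj_vsetr xy).
Qed.

Lemma params_at a b : adj G a b ->
  has_params G P (par_v a) (par_k a b) (par_r a) (par_b a) (par_d a b).
Proof.
move=> ab.
have conn x : x \in vset G -> exists y, adj G x y by apply: (sym_nbr symG).
split=> //.
- move=> _ _ /quot_adjP[x [y [xy -> ->]]]; split.
  + refine (arc_card symG (toU := to) (F := fun x y => pblock P x) _ xy ab).
    by move=> g x' y' u gX xy'; apply: mem_pblock_act; rewrite ?(adj_vset xy').
  + refine (arc_card symG (toU := to)
      (F := fun x y => pblock P x :&: nbr_set G (pblock P y)) _ xy ab).
    move=> g x' y' u gX xy' /setIP[ux]; rewrite !inE => /exists_inP[w wy uw].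
    rewrite mem_pblock_act ?(adj_vset xy') //=.
    apply/exists_inP; exists (to w g); last by rewrite (sym_adj symG).
    by rewrite mem_pblock_act ?(adj_vsetr xy').
  (* In the induced subgraph, the neighbours of a vertex z of one block are all its
  neighbours in the other block: none lies in its own block, and each of them has
  the neighbour z. *)
  have half x' y' z : adj G x' y' -> z \in pblock P x' :&: nbr_set G (pblock P y') ->
      #|[set w | adj (induced G ((pblock P x' :&: nbr_set G (pblock P y'))
          :|: (pblock P y' :&: nbr_set G (pblock P x')))) z w]| = par_d a b.
    move=> xy' zA; have := zA.
    case/setIP=> zx; rewrite inE => /exists_inP[w wy zw].
    have [xV yV] := (adj_vset xy', adj_vsetr xy').
    have /eqP zP : pblock P z == pblock P x'.
      by move: zx; rewrite (part_pblockE partP _ xV) => /andP[].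
    have /eqP wP : pblock P w == pblock P y'.
      by move: wy; rewrite (part_pblockE partP _ yV) => /andP[].
    rewrite -(par_d_arc ab zw) /par_d wP; apply: eq_card => t; rewrite 2!in_set.
    apply/and3P/andP => [[_ tA zt] | [ty zt]].
      split=> //; move: tA; rewrite in_setU !in_setI => /orP[/andP[tx _] | /andP[]//].
      have := adj_cross zt; rewrite zP; move: tx.
      by rewrite (part_pblockE partP _ xV) => /andP[_ /eqP->]; rewrite eqxx.
    split=> //; first by rewrite in_setU zA.
    rewrite in_setU; apply/orP; right; rewrite in_setI ty inE /=.
    by apply/exists_inP; exists z; rewrite // adj_sym.
  move=> z /setIP[_] /setUP[zA|zA]; first exact: half.
  by rewrite setUC; apply: half; rewrite // adj_sym.
- move=> x /conn[y xy].
  refine (arc_card symG (toU := to^*%act) (F := fun x y => adj_blocks G P x) _ xy ab).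
  by move=> g x' y' C gX _ Cx; rewrite adj_blocks_act // mem_setact.
move=> _ /(part_blockP partP)[x + ->] => /conn[y xy].
refine (arc_card symG (toU := to^*%act)
  (F := fun x y => [set C | adj (quot G P) (pblock P x) C]) _ xy ab).
move=> g x' y' C gX xy'; rewrite !inE pblock_act ?(adj_vset xy') // => adjC.
by rewrite (sym_adj quot_sym).
Qed.

Lemma par_v_const a b x : adj G a b -> x \in vset G -> #|pblock P x| = par_v a.
Proof.
move=> ab /(sym_nbr symG)[y xy]; have [_ vk _ _] := params_at ab.
by have [] := vk _ _ (quot_adj_pblock xy).
Qed.

Lemma par_v_gt0 a b : adj G a b -> 0 < par_v a.
Proof.
by move=> ab; apply/card_gt0P; exists a; rewrite (part_mem_pblock partP) (adj_vset ab).
Qed.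

Lemma par_k_gt0 a b : adj G a b -> 0 < par_k a b.
Proof.
move=> ab; apply/card_gt0P; exists a; rewrite !inE (part_mem_pblock partP).
rewrite (adj_vset ab); apply/exists_inP; exists b => //.
by rewrite (part_mem_pblock partP) (adj_vsetr ab).
Qed.

Lemma par_k_le a b : par_k a b <= par_v a.
Proof. by rewrite subset_leq_card ?subsetIl. Qed.

Lemma par_r_gt0 a b : adj G a b -> 0 < par_r a.
Proof. by move=> ab; apply/card_gt0P; exists (pblock P b); apply: mem_adj_blocks. Qed.

Lemma par_d_gt0 a b : adj G a b -> 0 < par_d a b.
Proof.
move=> ab; apply/card_gt0P; exists b.
by rewrite !inE ab (part_mem_pblock partP) (adj_vsetr ab).
Qed.

(** The neighbours of a vertex are sorted by their blocks: r classes of size d. *)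
Lemma valency_rd a b : adj G a b -> has_valency G (par_r a * par_d a b).
Proof.
move=> ab x xV; have [y xy] := sym_nbr symG xV.
rewrite (card_fibers (f := pblock P) (n := par_d a b)).
  by rewrite -adj_blocksE; congr (_ * _); case: (params_at ab) => _ _ -> //.
move=> z; rewrite inE => xz; rewrite -(par_d_arc ab xz) /par_d.
apply: eq_card => t; rewrite !inE (part_pblockE partP _ (adj_vsetr xz)).
by rewrite andbC; case: (boolP (adj G x t)) => xt; rewrite ?andbF // (adj_vsetr xt).
Qed.

(** Both sides count the pairs formed by a vertex of a fixed block and a block seen
by that vertex. *)
Lemma count_vr_bk a b : adj G a b -> par_v a * par_r a = par_b a * par_k a b.
Proof.
move=> ab; have [_ vkd rP _] := params_at ab; have aV := adj_vset ab.
have aP := part_pblock_mem partP aV.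
rewrite /par_v /par_b -!sum_nat_const.
rewrite (eq_bigr (fun x => \sum_(C | C \in adj_blocks G P x) 1)); last first.
  by move=> x xa; rewrite sum1_card rP // (part_block_sub partP aP).
rewrite (exchange_big_dep (mem [set C | adj (quot G P) (pblock P a) C])) /=.
  apply: eq_bigr => C; rewrite inE => adjC.
  have [_ <- _] := vkd _ _ adjC; rewrite sum1_card; apply: eq_card => x.
  by case/and4P: adjC => _ CP _ _; rewrite unfold_in /= !inE CP.
move=> x C xa Cx; rewrite inE -(part_def_pblock partP aP xa).
exact: adj_blocks_quot.
Qed.

Lemma par_uniq v k r b d x y : adj G x y -> has_params G P v k r b d ->
  v = par_v x /\ k = par_k x y.
Proof. by move=> xy [_ /(_ _ _ (quot_adj_pblock xy))[<- <- _]]. Qed.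

(** Two adjacent blocks are distinct, so a block is never the whole vertex set. *)
Lemma nontrivial_v x y : adj G x y -> nontrivial_partition G P <-> 1 < par_v x.
Proof.
move=> xy; have [xV yV] := (adj_vset xy, adj_vsetr xy).
have [_ vk _ _] := params_at xy.
have [vx _ _] := vk _ _ (quot_adj_pblock xy).
split=> [[_ /(part_blockP partP)[z /(sym_nbr symG)[w zw] ->]] | v1].
  by have [-> _ _] := vk _ _ (quot_adj_pblock zw) => /andP[].
exists (pblock P x); first exact: part_pblock_mem partP _ xV.
rewrite [1 < _]v1 /=; apply: proper_card; rewrite properEneq.
have sub: pblock P x \subset vset G.
  apply/subsetP => z; exact: part_block_sub partP _ _ (part_pblock_mem partP xV).
rewrite sub andbT; apply: contraNneq (adj_cross xy) => eqx.
move: yV; rewrite -eqx (part_pblockE partP _ xV) => /andP[_ /eqP->]; exact: eqxx.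
Qed.

(** If v = k, then r = b follows from v r = b k. *)
Lemma multicover_vk x y : adj G x y -> 1 < par_v x ->
  multicover G P <-> par_v x = par_k x y.
Proof.
move=> xy v1; split=> [[v [k [r [b [d [/(par_uniq xy)[-> ->] []//]]]]]] | vk].
have [v0 r0] := (ltnW v1, par_r_gt0 xy).
have rb : par_r x = par_b x.
  apply/eqP; rewrite -(eqn_pmul2l v0) (count_vr_bk xy) mulnC -vk; exact/eqP.
exists (par_v x), (par_k x y), (par_r x), (par_b x), (par_d x y).
by split; [exact: params_at | split; rewrite -?vk -?rb].
Qed.

Lemma mem_nbr_set x C : C \in P -> (x \in nbr_set G C) = (C \in adj_blocks G P x).
Proof. by move=> CP; rewrite !inE CP. Qed.

(** * The next partition and its stars *)

Lemma arc1_nbrs x : adj_blocks G P x = [set p.2 | p in arc1 G P x].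
Proof.
apply/setP=> C; apply/idP/imsetP => [Cx | [_ /imsetP[D Dx ->] ->]//].
by exists (pblock P x, C); rewrite ?imset_f.
Qed.

(** A star determines its centre because it is nonempty: no vertex is isolated. *)
Lemma arc1_eqP x y : x \in vset G ->
  reflect (pblock P x = pblock P y /\ adj_blocks G P x = adj_blocks G P y)
          (arc1 G P x == arc1 G P y).
Proof.
move=> xV; apply: (iffP eqP) => [eqxy | [eqB eqA]]; last by rewrite /arc1 eqB eqA.
have [z xz] := sym_nbr symG xV.
split; last by rewrite !arc1_nbrs eqxy.
have: (pblock P x, pblock P z) \in arc1 G P x by rewrite imset_f ?mem_adj_blocks.
by rewrite eqxy => /imsetP[C _ []].
Qed.

Lemma arc1_act g x : g \in X -> x \in vset G ->
  arc1 G P (to x g) = (pair_action to^*)^*%act (arc1 G P x) g.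
Proof.
move=> gX xV; rewrite /arc1 adj_blocks_act // pblock_act //.
apply/setP=> p; apply/imsetP/imsetP => [[_ /imsetP[C Cx ->] ->]|].
  by exists (pblock P x, C) => //; rewrite imset_f.
by case=> _ /imsetP[C Cx ->] ->; exists (to^*%act C g) => //; apply: mem_setact.
Qed.

Lemma next_preim : next_partition G P = preim_partition (arc1 G P) (vset G).
Proof.
apply: eq_imset => x; apply/setP=> y; rewrite !inE eq_sym; by [].
Qed.

Lemma next_partitionP : partition (next_partition G P) (vset G).
Proof. by rewrite next_preim preim_partitionP. Qed.

Lemma next_pblock x : x \in vset G ->
  pblock (next_partition G P) x = [set y in vset G | arc1 G P y == arc1 G P x].
Proof.
move=> xV; apply: (part_def_pblock next_partitionP); first by apply/imsetP; exists x.
by rewrite !inE xV eqxx.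
Qed.

Lemma next_pblockE x y : x \in vset G -> y \in vset G ->
  (pblock (next_partition G P) x == pblock (next_partition G P) y)
    = (arc1 G P x == arc1 G P y).
Proof.
move=> xV yV; apply/eqP/eqP => [eqN | eqA]; last by rewrite !next_pblock // eqA.
have := part_mem_pblock next_partitionP x.
by rewrite eqN next_pblock // xV inE => /andP[_ /eqP].
Qed.

Lemma next_invariant : invariant_partition to X G (next_partition G P).
Proof.
split; first exact: next_partitionP.
apply: acts_on => _ g gX /imsetP[x xV ->].
apply/imsetP; exists (to x g); first by rewrite (sym_mem symG).
apply/setP=> y; rewrite !inE; apply/imsetP/andP => [[z + ->] | [yV /eqP yx]].
  by rewrite !inE (sym_mem symG) // => /andP[zV /eqP zx]; rewrite !arc1_act // zx.
have y'V : to y g^-1%g \in vset G by rewrite (sym_mem symG) ?groupV.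
exists (to y g^-1%g); last by rewrite actKV.
by rewrite !inE y'V arc1_act ?groupV // yx arc1_act // actK eqxx.
Qed.


(** The equality k = v means that a block adjacent to C lies entirely in Gamma(C),
so that all its vertices see the same blocks. *)
Lemma next_fixP x y : adj G x y ->
  next_partition G P = P <-> par_v x = par_k x y.
Proof.
move=> xy; have [xV yV] := (adj_vset xy, adj_vsetr xy).
split=> [fixP | vk].
  rewrite /par_v /par_k; apply: eq_card => z; rewrite in_setI.
  case: (boolP (z \in pblock P x)) => //= zx; apply/esym.
  have: z \in pblock (next_partition G P) x by rewrite fixP.
  rewrite next_pblock // inE => /andP[zV /eqP zA].
  rewrite mem_nbr_set ?(part_pblock_mem partP) // arc1_nbrs zA -arc1_nbrs.
  exact: mem_adj_blocks.
have subA z w : z \in vset G -> w \in vset G -> pblock P z = pblock P w ->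
    adj_blocks G P z \subset adj_blocks G P w.
  move=> zV wV zw; apply/subsetP => C Cz; have adjC := adj_blocks_quot Cz.
  have [_ /(_ _ _ adjC)[v1 k1 _] _ _] := params_at xy.
  have /eqP fullz : pblock P z :&: nbr_set G C == pblock P z.
    by rewrite eqEcard subsetIl k1 v1 vk leqnn.
  have CP : C \in P by case/and4P: adjC.
  have: w \in pblock P z by rewrite zw (part_mem_pblock partP).
  by rewrite -mem_nbr_set // -{1}fullz => /setIP[].
apply: (part_eq next_partitionP partP) => z zV; rewrite next_pblock //.
apply/setP=> w; rewrite inE (part_pblockE partP _ zV).
case: (boolP (w \in vset G)) => //= wV; apply/arc1_eqP/eqP => // [[]//|zw].
by split=> //; apply/eqP; rewrite eqEsubset !subA.
Qed.

Lemma next_refines x y : x \in vset G -> y \in vset G ->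
  pblock (next_partition G P) x = pblock (next_partition G P) y ->
  pblock P x = pblock P y.
Proof. by move=> xV yV /eqP; rewrite next_pblockE // => /arc1_eqP[]. Qed.

Lemma star_at_arc1 x y : adj G x y ->
  star_at (quot G P) (par_r x) (pblock P x) (arc1 G P x).
Proof.
move=> xy; split; first exact: par_r_gt0 xy.
- by rewrite card_imset // => C D [].
- apply/subsetP=> _ /imsetP[C Cx ->]; rewrite inE; exact: adj_blocks_quot.
by move=> _ /imsetP[C _ ->].
Qed.

Lemma arc1_double_star a b p : adj G a b -> p \in arc1_pairs G P ->
  double_star (quot G P) (par_r a) p.
Proof.
move=> ab /imsetP[[x y] + ->]; rewrite inE /= => xy.
have yx : adj G y x by rewrite adj_sym.
have [_ _ rP _] := params_at ab.
have rE z : z \in vset G -> par_r a = par_r z by move/rP.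
exists (pblock P x), (pblock P y); split.
- by rewrite (rE x) ?(adj_vset xy) //; apply: star_at_arc1 xy.
- by rewrite (rE y) ?(adj_vset yx) //; apply: star_at_arc1 yx.
- by rewrite imset_f ?mem_adj_blocks.
by rewrite imset_f ?mem_adj_blocks.
Qed.

Lemma arc1_self_paired : self_paired (arc1_pairs G P).
Proof.
move=> _ /imsetP[[x y] + ->]; rewrite inE /= => xy.
by apply/imsetP; exists (y, x); rewrite ?inE //= adj_sym.
Qed.

Lemma arc1_star_vset : star_vset (arc1_pairs G P) = arc1 G P @: vset G.
Proof.
apply/setP=> S; apply/setUP/imsetP.
  case=> /imsetP[_ /imsetP[[x y] + ->] ->]; rewrite inE /= => xy.
    by exists x; rewrite // (adj_vset xy).
  by exists y; rewrite // (adj_vsetr xy).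
case=> x /(sym_nbr symG)[y xy] ->; left; apply/imsetP.
by exists (arc1 G P x, arc1 G P y) => //; apply/imsetP; exists (x, y); rewrite ?inE.
Qed.

Lemma dsg_vsetE :
  vset (double_star_graph (arc1_pairs G P)) = arc1 G P @: vset G.
Proof. exact: arc1_star_vset. Qed.

(** An element that fixes x fixes its star, and by arc-transitivity the stabilizer
of x is transitive on the neighbours of x, hence on the star. *)
Lemma arc1_rank_transitive : rank_transitive to^* X (arc1_pairs G P).
Proof.
have [[a [b ab]] _ _ _ _] := symG; split.
- apply: (@transitive_on _ _ _ _ _ (arc1 G P a, arc1 G P b)).
  + by apply/imsetP; exists (a, b); rewrite ?inE.
  + move=> _ g gX /imsetP[[x y] + ->]; rewrite inE /= => xy.
    apply/imsetP; exists (to x g, to y g); first by rewrite inE /= (sym_adj symG).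
    by rewrite /= !arc1_act ?(adj_vset xy) ?(adj_vsetr xy).
  move=> _ _ /imsetP[[x y] + ->] /imsetP[[x' y'] + ->]; rewrite !inE /= => xy xy'.
  have [g [gX -> ->]] := sym_arc symG xy xy'; exists g => //.
  by rewrite /= !arc1_act ?(adj_vset xy) ?(adj_vsetr xy).
- rewrite arc1_star_vset; apply: (@transitive_on _ _ _ _ _ (arc1 G P a)).
  + by rewrite imset_f ?(adj_vset ab).
  + move=> _ g gX /imsetP[x xV ->]; apply/imsetP; exists (to x g).
      by rewrite (sym_mem symG).
    by rewrite arc1_act.
  move=> _ _ /imsetP[x xV ->] /imsetP[y yV ->].
  have [g gX ->] := sym_vertex symG xV yV; exists g => //.
  by rewrite arc1_act.
move=> S; rewrite arc1_star_vset => /imsetP[x xV ->{S}].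
have [y xy] := sym_nbr symG xV.
apply: (@transitive_on _ _ _ _ _ (pblock P x, pblock P y)).
- by rewrite imset_f ?mem_adj_blocks.
- by move=> p g /setIP[_ /astabsP stabg] px; rewrite stabg.
move=> _ _ /imsetP[C Cx ->] /imsetP[D Dx ->]; move: Cx Dx.
rewrite adj_blocksE => /imsetP[u + ->] /imsetP[w + ->]; rewrite !inE => xu xw.
have [g [gX xg wg]] := sym_arc symG xu xw; exists g.
  rewrite inE gX /=; apply/astabsP => p.
  have arcg : (pair_action to^*)^*%act (arc1 G P x) g = arc1 G P x.
    by rewrite -arc1_act // -xg.
  rewrite -{1}arcg; apply/imsetP/idP => [[q qx /(act_inj (pair_action to^*)) -> //]|px].
  by exists p.
by rewrite /= /pair_act /= -!pblock_act ?(adj_vsetr xu) // -xg -wg.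
Qed.

Lemma par_r_lt_b a b : adj G a b -> par_k a b < par_v a -> par_r a < par_b a.
Proof.
move=> ab kv; rewrite -(ltn_pmul2l (par_v_gt0 ab)) (count_vr_bk ab) mulnC.
rewrite ltn_pmul2r //.
have : 0 < par_v a * par_r a by rewrite muln_gt0 (par_v_gt0 ab) (par_r_gt0 ab).
by rewrite (count_vr_bk ab) muln_gt0 => /andP[].
Qed.

Lemma arc1_star_base a b : adj G a b -> par_k a b < par_v a ->
  star_base to^* X (quot G P) (par_r a).
Proof.
move=> ab kv; have rb := par_r_lt_b ab kv; split; first exact: quot_sym.
exists (par_b a); have [_ _ _ bP] := params_at ab; split=> //.
  by apply: leq_trans rb; rewrite ltnS (par_r_gt0 ab).
by case: par_b rb.
Qed.

(** The orientation that is lost in passing to the edges of the double-star graph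
is recovered from the symmetry of G; the two stars of a double-star differ
because their centres do. *)
Lemma dsg_adjP S S' :
  reflect (exists x y, [/\ adj G x y, S = arc1 G P x & S' = arc1 G P y])
          (adj (double_star_graph (arc1_pairs G P)) S S').
Proof.
apply: (iffP andP) => [[nS /imsetP[_ /imsetP[[x y] + ->] /=]] | [x [y [xy -> ->]]]].
  rewrite inE /= => xy eqS.
  have := set21 S S'; have := set22 S S'; rewrite eqS.
  case/set2P=> ES' /set2P[] ES; rewrite ES ES' ?eqxx // in nS *.
    by exists y, x; rewrite adj_sym.
  by exists x, y.
split; last first.
  apply/imsetP; exists (arc1 G P x, arc1 G P y) => //.
  by apply/imsetP; exists (x, y); rewrite ?inE.
by apply: contraNneq (adj_cross xy) => /eqP/(arc1_eqP _ (adj_vset xy))[-> _].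
Qed.

End Blocks.

Section Next.
Variables (gT : finGroupType) (T : finType) (to : {action gT &-> T}).
Variables (X : {group gT}) (G : graph T) (P : {set {set T}}).
Hypothesis symG : X_symmetric to X G.
Hypothesis invP : invariant_partition to X G P.
Hypothesis edgeP : has_edge (quot G P).

Let invN := next_invariant symG invP.
Let partN : partition (next_partition G P) (vset G) := invN.1.

Lemma refine_edge Q : partition Q (vset G) ->
    {in vset G &, forall x y, pblock Q x = pblock Q y -> pblock P x = pblock P y} ->
  has_edge (quot G Q).
Proof.
move=> partQ PQ; have [[x [y xy]] _ _ _ _] := symG.
have [xV yV] := (adj_vset xy, adj_vsetr xy).
exists (pblock Q x), (pblock Q y); apply/and4P; split.
- exact: (part_pblock_mem partQ).
- exact: (part_pblock_mem partQ).
- by apply: contraNneq (adj_cross symG invP edgeP xy) => /PQ->.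
apply/exists_inP; exists x; rewrite ?(part_mem_pblock partQ) //.
by apply/exists_inP; exists y; rewrite ?(part_mem_pblock partQ).
Qed.

Lemma next_edge : has_edge (quot G (next_partition G P)).
Proof. by apply: refine_edge partN _ => x y; apply: (next_refines symG). Qed.

(** All vertices of a block of the next partition have the same star, so the union
of their stars is that common star. This avoids choosing a representative. *)
Lemma next_iso :
  graph_iso (quot G (next_partition G P)) (double_star_graph (arc1_pairs G P)).
Proof.
pose f (D : {set T}) := \bigcup_(x in D) arc1 G P x.
have fE x : x \in vset G -> f (pblock (next_partition G P) x) = arc1 G P x.
  move=> xV; apply/setP=> p; apply/bigcupP/idP => [[y + py] | px].
    by rewrite next_pblock // inE => /andP[_ /eqP <-].
  by exists x => //; rewrite (part_mem_pblock partN).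
have arcN x y : x \in vset G -> y \in vset G -> arc1 G P x = arc1 G P y ->
    pblock (next_partition G P) x = pblock (next_partition G P) y.
  by move=> xV yV eqA; apply/eqP; rewrite next_pblockE // eqA.
exists f; split.
- move=> _ _ /(part_blockP partN)[x xV ->] /(part_blockP partN)[y yV ->].
  by rewrite !fE //; apply: arcN.
- rewrite (dsg_vsetE P symG); apply/setP=> S.
  apply/imsetP/imsetP => [[_ /(part_blockP partN)[x xV ->] ->] | [x xV ->]].
    by exists x; rewrite ?fE.
  by exists (pblock (next_partition G P) x); rewrite ?fE //; apply: (part_pblock_mem partN).
move=> _ _ /(part_blockP partN)[x xV ->] /(part_blockP partN)[y yV ->].
have quotP := quot_adjP symG invN next_edge; rewrite !fE //.
apply/(dsg_adjP symG invP edgeP)/quotP => -[a [b [ab eqx eqy]]]; exists a, b; split=> //.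
- by apply: arcN => //; apply: adj_vset ab.
- by apply: arcN => //; apply: adj_vsetr ab.
- by apply/eqP; rewrite -next_pblockE ?eqx // (adj_vset ab).
by apply/eqP; rewrite -next_pblockE ?eqy // (adj_vsetr ab).
Qed.

(** If the blocks are single vertices, distinct vertices have distinct stars, so
[arc1] is the isomorphism. *)
Lemma discrete_next_iso : {in vset G, forall x, #|pblock (next_partition G P) x| = 1} ->
  graph_iso G (double_star_graph (arc1_pairs G P)).
Proof.
move=> disc.
have inj : {in vset G &, injective (arc1 G P)}.
  move=> x y xV yV eqA; have /eqP/cards1P[z Ez] := disc x xV.
  have := part_mem_pblock partN x; rewrite Ez xV => /set1P->.
  have /eqP eqN: pblock (next_partition G P) x == pblock (next_partition G P) y.
    by rewrite next_pblockE // eqA.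
  by have := part_mem_pblock partN y; rewrite -eqN Ez yV => /set1P->.
exists (arc1 G P); split=> //; first by rewrite (dsg_vsetE P symG).
move=> x y xV yV; apply/(dsg_adjP symG invP edgeP)/idP => [[a [b [ab eqx eqy]]]|xy].
  have -> : x = a by apply: inj => //; apply: adj_vset ab.
  by have -> : y = b by apply: inj => //; apply: adj_vsetr ab.
by exists x, y.
Qed.

End Next.

(** * A partition finer than the next one *)

Section Refinement.
Variables (gT : finGroupType) (T : finType) (to : {action gT &-> T}).
Variables (X : {group gT}) (G : graph T) (P Q : {set {set T}}).
Hypothesis symG : X_symmetric to X G.
Hypothesis invP : invariant_partition to X G P.
Hypothesis edgeP : has_edge (quot G P).
Hypothesis invQ : invariant_partition to X G Q.
Hypothesis refPQ : {in vset G &, forall x y,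
  pblock Q x = pblock Q y -> arc1 G P x = arc1 G P y}.

Let partP : partition P (vset G) := invP.1.
Let partQ : partition Q (vset G) := invQ.1.
Let qG := quot G Q.
Let qP := quot_partition P Q.
Let phi (B : {set T}) : {set {set T}} := [set D in Q | D \subset B].

Lemma refine_pblock x y : x \in vset G -> y \in vset G ->
  pblock Q x = pblock Q y -> pblock P x = pblock P y.
Proof. by move=> xV yV /refPQ-/(_ xV yV)/eqP/(arc1_eqP symG invP _ xV)[]. Qed.

Lemma refine_adj_blocks x y : x \in vset G -> y \in vset G ->
  pblock Q x = pblock Q y -> adj_blocks G P x = adj_blocks G P y.
Proof. by move=> xV yV /refPQ-/(_ xV yV)/eqP/(arc1_eqP symG invP _ xV)[]. Qed.

Let edgeQ : has_edge (quot G Q).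
Proof. by apply: refine_edge symG invP edgeP _ partQ _ => x y; apply: refine_pblock. Qed.

Let symQ : X_symmetric to^* X qG := quot_sym symG invQ edgeQ.

Lemma mem_phi x y : x \in vset G -> y \in vset G ->
  (pblock Q x \in phi (pblock P y)) = (pblock P x == pblock P y).
Proof.
move=> xV yV; rewrite inE (part_pblock_mem partQ) //=; apply/subsetP/eqP => [sub | eqPxy z].
  have := sub x; rewrite (part_mem_pblock partQ) => /(_ xV).
  by rewrite (part_pblockE partP _ yV) => /andP[_ /eqP].
rewrite (part_pblockE partQ _ xV) => /andP[zV /eqP zx].
by rewrite (part_pblockE partP _ yV) zV (refine_pblock zV xV zx) eqPxy eqxx.
Qed.

Lemma phiP y D : y \in vset G -> D \in phi (pblock P y) ->
  exists x, [/\ x \in vset G, D = pblock Q x & pblock P x = pblock P y].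
Proof.
move=> yV Dy; have /setIdP[/(part_blockP partQ)[x xV ED] _] := Dy.
by exists x; split=> //; apply/eqP; rewrite -mem_phi // -ED.
Qed.

Lemma cover_phi B : B \in P -> cover (phi B) = B.
Proof.
case/(part_blockP partP) => y yV ->; apply/setP=> x; apply/bigcupP/idP.
  by case=> D /setIdP[_ /subsetP sub]; apply: sub.
move=> xy; have := xy; rewrite (part_pblockE partP _ yV) => /andP[xV /eqP eqxy].
by exists (pblock Q x); rewrite ?(part_mem_pblock partQ) // mem_phi // eqxy.
Qed.

Lemma phi_inj : {in P &, injective phi}.
Proof. by move=> B C BP CP eqphi; rewrite -(cover_phi BP) eqphi cover_phi. Qed.

Lemma quot_partitionP : partition qP Q.
Proof.
have selfphi x : x \in vset G -> pblock Q x \in phi (pblock P x)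
  by move=> xV; rewrite mem_phi.
apply/and3P; split.
- apply/eqP/setP=> D; apply/bigcupP/idP => [[_ /imsetP[B _ ->] /setIdP[]//] |].
  case/(part_blockP partQ) => x xV ->; exists (phi (pblock P x)); last exact: selfphi.
  by apply/imsetP; exists (pblock P x) => //; apply: (part_pblock_mem partP).
- apply/trivIsetP => _ _ /imsetP[B /(part_blockP partP)[x xV ->] ->]
    /imsetP[C /(part_blockP partP)[y yV ->] ->] neq.
  rewrite -setI_eq0; apply: contraNT neq => /set0Pn[D /setIP[Dx Dy]].
  have [z [zV ED zx]] := phiP xV Dx; have [w [wV ED' wy]] := phiP yV Dy.
  by rewrite -zx -wy (refine_pblock zV wV) // -ED -ED'.
apply/imsetP=> -[B /(part_blockP partP)[x xV ->] eq0].
by have := selfphi x xV; rewrite /phi -eq0 inE.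
Qed.

Lemma pblock_quot x : x \in vset G -> pblock qP (pblock Q x) = phi (pblock P x).
Proof.
move=> xV; apply: (part_def_pblock quot_partitionP); last by rewrite mem_phi.
by apply/imsetP; exists (pblock P x) => //; apply: (part_pblock_mem partP).
Qed.

Lemma quot_invariant : invariant_partition to^* X qG qP.
Proof.
split; first exact: quot_partitionP.
apply: acts_on => _ g gX /imsetP[B BP ->].
apply/imsetP; exists (to^*%act B g); first by rewrite (block_act invP).
apply/setP=> D; rewrite inE; apply/imsetP/andP => [[C /setIdP[CQ sub] ->] | [DQ sub]].
  by rewrite (block_act invQ) // CQ imsetS.
exists (to^*%act D g^-1%g); last by rewrite actKV.
rewrite inE (block_act invQ) ?groupV // DQ /=.
by rewrite -(actK to^* g B) imsetS.
Qed.

Lemma quot_edge : has_edge (quot qG qP).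
Proof.
have [[x [y xy]] _ _ _ _] := symG; have [xV yV] := (adj_vset xy, adj_vsetr xy).
exists (phi (pblock P x)), (phi (pblock P y)).
have [Px Py] := (part_pblock_mem partP xV, part_pblock_mem partP yV).
apply/and4P; split; [by apply: imset_f | by apply: imset_f | |].
  by apply: contraNneq (adj_cross symG invP edgeP xy) => /phi_inj->.
apply/exists_inP; exists (pblock Q x); first by rewrite mem_phi.
apply/exists_inP; exists (pblock Q y); first by rewrite mem_phi.
exact: (quot_adj_pblock symG invQ edgeQ).
Qed.

Let invqP := quot_invariant.
Let edgeqP := quot_edge.

Lemma adj_phi B C : B \in P -> C \in P ->
  adj (quot qG qP) (phi B) (phi C) = adj (quot G P) B C.
Proof.
move=> BP CP.
apply/(quot_adjP symQ invqP edgeqP)/(quot_adjP symG invP edgeP).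
  case=> _ [_ [/(quot_adjP symG invQ edgeQ)[x [y [xy -> ->]]]]].
  have [xV yV] := (adj_vset xy, adj_vsetr xy).
  rewrite !pblock_quot // => /phi_inj-> //; last exact: (part_pblock_mem partP).
  by move=> /phi_inj->; [exists x, y | | apply: (part_pblock_mem partP)].
case=> x [y [xy -> ->]]; exists (pblock Q x), (pblock Q y).
rewrite !pblock_quot ?(adj_vset xy) ?(adj_vsetr xy) //; split=> //.
exact: (quot_adj_pblock symG invQ edgeQ).
Qed.

(** The union of blocks inverts the passage from a block of P to the set of blocks
of Q that it contains. *)
Lemma quot_iso : graph_iso (quot qG qP) (quot G P).
Proof.
exists (@cover T); split.
- by move=> _ _ /imsetP[B BP ->] /imsetP[C CP ->]; rewrite !cover_phi // => ->.
- apply/setP=> B; apply/imsetP/idP => [[_ /imsetP[C CP ->] ->] | BP].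
    by rewrite cover_phi.
  by exists (phi B); rewrite ?cover_phi //; apply: imset_f.
move=> _ _ /imsetP[B BP ->] /imsetP[C CP ->].
by rewrite !cover_phi // -adj_phi.
Qed.

Section FixedArc.
Variables x y : T.
Hypothesis xy : adj G x y.
Let xV : x \in vset G := adj_vset xy.
Let yV : y \in vset G := adj_vsetr xy.
Let qxy : adj qG (pblock Q x) (pblock Q y) := quot_adj_pblock symG invQ edgeQ xy.

Lemma refine_v : par_v P x = par_v qP (pblock Q x) * par_v Q x.
Proof.
rewrite {1}/par_v (card_fibers (f := pblock Q) (n := par_v Q x)) => [|z].
  congr (_ * _); rewrite /par_v pblock_quot //; apply: eq_card => D.
  apply/imsetP/idP => [[z + ->] | /(phiP xV)[z [zV -> zx]]].
    by rewrite (part_pblockE partP _ xV) => /andP[zV]; rewrite mem_phi.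
  by exists z; rewrite // (part_pblockE partP _ xV) zV zx eqxx.
rewrite (part_pblockE partP _ xV) => /andP[zV /eqP zx].
rewrite -(par_v_const symG invQ edgeQ xy zV); apply: eq_card => w; rewrite inE.
rewrite (part_pblockE partP _ xV) (part_pblockE partQ _ zV).
apply/andP/andP => [[/andP[-> _] ->] // | [wV /eqP wz]].
by rewrite wV wz (refine_pblock wV zV wz) zx !eqxx.
Qed.

(** Here refinement of P alone would not be enough: vertices in the same block of Q
must also see the same blocks of P for B :&: Gamma(C) to be a union of blocks
of Q. *)
Lemma refine_k : par_k G P x y = par_k qG qP (pblock Q x) (pblock Q y) * par_v Q x.
Proof.
have yP := part_pblock_mem partP yV.
rewrite {1}/par_k (card_fibers (f := pblock Q) (n := par_v Q x)) => [|z].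
  congr (_ * _); rewrite /par_k !pblock_quot //; apply: eq_card => D.
  rewrite in_setI; apply/imsetP/andP => [[z + ->] | [Dx]].
    rewrite in_setI (part_pblockE partP _ xV) => /andP[/andP[zV zx]].
    rewrite inE => /exists_inP[w wy zw]; rewrite mem_phi // zx inE; split=> //.
    have wV := part_block_sub partP yP wy.
    apply/exists_inP; exists (pblock Q w).
      by rewrite mem_phi //; move: wy; rewrite (part_pblockE partP _ yV) => /andP[].
    exact: (quot_adj_pblock symG invQ edgeQ).
  rewrite inE => /exists_inP[D' Dy /(quot_adjP symG invQ edgeQ)[z [w [zw ED ED']]]].
  have [zV wV] := (adj_vset zw, adj_vsetr zw).
  exists z => //; rewrite in_setI (part_pblockE partP _ xV) zV -mem_phi // -ED Dx inE.
  apply/exists_inP; exists w => //.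
  by rewrite (part_pblockE partP _ yV) wV -mem_phi // -ED'.
rewrite in_setI (part_pblockE partP _ xV) => /andP[/andP[zV /eqP zx]].
rewrite (mem_nbr_set _ _ yP) => zA.
rewrite -(par_v_const symG invQ edgeQ xy zV); apply: eq_card => w; rewrite inE in_setI.
rewrite (part_pblockE partP _ xV) (part_pblockE partQ _ zV) (mem_nbr_set _ _ yP).
apply/andP/andP => [[/andP[/andP[-> _] _] ->] // | [wV /eqP wz]].
by rewrite wV wz (refine_adj_blocks wV zV wz) zA (refine_pblock wV zV wz) zx !eqxx.
Qed.

Lemma refine_r : par_r qG qP (pblock Q x) = par_r G P x.
Proof.
rewrite /par_r -[RHS](card_in_imset (f := phi)); last first.
  by apply: sub_in2 phi_inj => C /setIdP[].
apply: eq_card => E; rewrite (adj_blocksE invqP).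
apply/imsetP/imsetP => [[D + ->] | [C + ->]].
  rewrite inE => /(quot_adjP symG invQ edgeQ)[z [w [zw eqxz ->]]].
  have [zV wV] := (adj_vset zw, adj_vsetr zw).
  exists (pblock P w); last by rewrite pblock_quot.
  by rewrite (refine_adj_blocks xV zV eqxz) (mem_adj_blocks invP).
rewrite (adj_blocksE invP) => /imsetP[w + ->]; rewrite inE => xw.
exists (pblock Q w); last by rewrite pblock_quot // (adj_vsetr xw).
by rewrite inE (quot_adj_pblock symG invQ edgeQ).
Qed.

Lemma refine_b : par_b qG qP (pblock Q x) = par_b G P x.
Proof.
have xP := part_pblock_mem partP xV.
rewrite /par_b -[RHS](card_in_imset (f := phi)); last first.
  by move=> B C; rewrite !inE => /and4P[_ BP _ _] /and4P[_ CP _ _]; apply: phi_inj.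
apply: eq_card => E; rewrite pblock_quot //; apply/idP/imsetP => [|[C + ->]].
  rewrite in_set => adjE; have /and4P[_ /imsetP[C CP EC] _ _] := adjE.
  by exists C => //; rewrite in_set -adj_phi //; move: adjE; rewrite EC.
rewrite !in_set => adjC; have /and4P[_ CP _ _] := adjC.
by rewrite adj_phi.
Qed.

(** The identity val = r d, applied to the quotient by Q, whose valency is b_Q. *)
Lemma refine_d :
  par_b G Q x = par_r G P x * par_d qG qP (pblock Q x) (pblock Q y).
Proof.
have [_ _ _ valQ] := params_at symG invQ edgeQ xy.
have := valency_rd symQ invqP edgeqP qxy; rewrite refine_r.
by apply: valency_uniq valQ; apply: adj_vset qxy.
Qed.

(** The neighbours of x in the block of y for P are sorted by their blocks for Q. *)
Lemma dvd_d : par_d G Q x y %| par_d G P x y.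
Proof.
rewrite {2}/par_d (card_fibers (f := pblock Q) (n := par_d G Q x y)) ?dvdn_mull // => z.
rewrite inE (part_pblockE partP _ yV) => /andP[/andP[zV /eqP zy] xz].
rewrite -(par_d_arc symG invQ xy xz); apply: eq_card => w; rewrite !inE.
rewrite (part_pblockE partP _ yV) (part_pblockE partQ _ zV).
case: (boolP (w \in vset G)) => //= wV.
case: (pblock Q w =P pblock Q z) => [wz|]; rewrite ?andbF //=.
by rewrite (refine_pblock wV zV wz) zy eqxx andbT.
Qed.

(** Immediate from [dvd_d], as r d is the valency of G for both partitions. *)
Lemma dvd_r : par_r G P x %| par_r G Q x.
Proof.
have eq_val := valency_uniq xV (valency_rd symG invP edgeP xy)
  (valency_rd symG invQ edgeQ xy).
by rewrite -(dvdn_pmul2r (par_d_gt0 invQ xy)) -eq_val dvdn_mul // dvd_d.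
Qed.

Lemma par_v_refine_le_k : par_v Q x <= par_k G P x y.
Proof. by rewrite dvdn_leq ?(par_k_gt0 invP xy) // refine_k dvdn_mull. Qed.

Lemma quot_params : has_params qG qP (par_v P x %/ par_v Q x)
  (par_k G P x y %/ par_v Q x) (par_r G P x) (par_b G P x)
  (par_b G Q x %/ par_r G P x).
Proof.
rewrite refine_v refine_k refine_d mulKn ?(par_r_gt0 invP xy) //.
rewrite !mulnK ?(par_v_gt0 invQ xy) // -refine_r -refine_b.
exact: (params_at symQ invqP edgeqP).
Qed.

(** The inequality k < v passes to the quotient because both sides are divided by
the size of the blocks of Q. *)
Lemma quot_in_calG : par_k G P x y < par_v P x -> in_calG to^* X qG qP.
Proof.
move=> kv; have v1 : 1 < par_v qP (pblock Q x).
  rewrite -(ltn_pmul2r (par_v_gt0 invQ xy)) mul1n -refine_v.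
  exact: leq_ltn_trans par_v_refine_le_k kv.
split=> //; first by apply/(nontrivial_v symQ invqP edgeqP qxy).
move/(multicover_vk symQ invqP edgeqP qxy v1) => vk.
by move: kv; rewrite refine_v refine_k vk ltnn.
Qed.

End FixedArc.

End Refinement.

(** * The chain of partitions *)

Section Chain.
Variables (gT : finGroupType) (T : finType) (to : {action gT &-> T}).
Variables (X : {group gT}) (G : graph T) (P : {set {set T}}).
Hypothesis symG : X_symmetric to X G.
Hypothesis invP : invariant_partition to X G P.
Hypothesis edgeP : has_edge (quot G P).

Let B := partition_seq G P.

Lemma seq_invariant_edge i :
  invariant_partition to X G (B i) /\ has_edge (quot G (B i)).
Proof.
elim: i => [|i [invB edgeB]]; first by [].
split; first exact: next_invariant symG invB.
exact: next_edge symG invB edgeB.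
Qed.

Let invB i : invariant_partition to X G (B i) := (seq_invariant_edge i).1.
Let edgeB i : has_edge (quot G (B i)) := (seq_invariant_edge i).2.

(** All later terms of the chain, not only the next one, are as fine as the
comparison of two partitions requires: each term refines the preceding one. *)
Lemma seq_refines i j : i < j -> {in vset G &, forall x y,
  pblock (B j) x = pblock (B j) y -> arc1 G (B i) x = arc1 G (B i) y}.
Proof.
elim: j => // j IHj; rewrite ltnS leq_eqVlt => /predU1P[-> | ltij] x y xV yV eqj.
  by apply/eqP; rewrite -next_pblockE //; apply/eqP.
by apply: IHj => //; apply: (next_refines symG (invB j)) eqj.
Qed.

Lemma seq_coarsens i : coarsens (B i) (B i.+1).
Proof.
apply/(coarsensP (invB i).1 (invB i.+1).1) => x y xV yV.
exact: (next_refines symG (invB i)).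
Qed.

Section Arc.
Variables a c : T.
Hypothesis ac : adj G a c.

Lemma seq_k_lt_v i : B i <> B i.+1 -> par_k G (B i) a c < par_v (B i) a.
Proof.
move=> nfix; rewrite ltn_neqAle par_k_le andbT; apply/eqP => kv; apply: nfix.
exact/esym/(next_fixP symG (invB i) (edgeB i) ac).
Qed.

Lemma seq_v_le_k i j : i < j -> par_v (B j) a <= par_k G (B i) a c.
Proof.
move/seq_refines => refij.
exact: (par_v_refine_le_k symG (invB i) (edgeB i) (invB j) refij).
Qed.

(** As long as the chain moves, v_(i+1) <= k_i < v_i, so it cannot move more than
v_0 times. *)
Lemma seq_stabilizes : exists i, B i == B i.+1.
Proof.
have drop n : (exists i, B i == B i.+1) \/ par_v (B n) a + n <= par_v (B 0) a.
  elim: n => [|n [|IHn]]; [by right; rewrite addn0 | by left |].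
  case: (B n =P B n.+1) => [/eqP fixn | nfix]; [by left; exists n | right].
  rewrite addnS; apply: leq_trans IHn; rewrite -addSn leq_add2r.
  exact: leq_ltn_trans (seq_v_le_k (ltnSn n)) (seq_k_lt_v nfix).
have [//|le0] := drop (par_v (B 0) a).
by have := leq_trans (leq_add (par_v_gt0 (invB _) ac) (leqnn _)) le0; rewrite ltnn.
Qed.

Lemma seq_in_calG i : B i <> B i.+1 -> in_calG to X G (B i).
Proof.
move=> nfix; have kv := seq_k_lt_v nfix.
have v1 : 1 < par_v (B i) a := leq_ltn_trans (par_k_gt0 (invB i) ac) kv.
split=> //; first exact/(nontrivial_v symG (invB i) (edgeB i) ac).
move/(multicover_vk symG (invB i) (edgeB i) ac v1) => vk.
by move: kv; rewrite vk ltnn.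
Qed.

End Arc.

Lemma seq_stationary m i : B m = B m.+1 -> m <= i -> B i = B m.
Proof. by move=> fixm /subnK<-; elim: (i - m) => //= k IHk; rewrite {}IHk. Qed.

End Chain.

Lemma refinement_chain_uniq (gT : finGroupType) (T : finType)
    (to : {action gT &-> T}) (X : {group gT}) (G : graph T) P m m' :
  refinement_chain to X G P m -> refinement_chain to X G P m' -> m = m'.
Proof.
suff le n n' : refinement_chain to X G P n -> refinement_chain to X G P n' -> n <= n'.
  by move=> cm cm'; apply/eqP; rewrite eqn_leq !le.
case=> _ _ strict _ [_ _ _ fixed]; rewrite leqNgt; apply/negP => /strict[_].
by apply; apply: fixed.
Qed.

(** * The theorem *)

Theorem theorem4p1 (gT : finGroupType) (T : finType)
    (to : {action gT &-> T}) (X : {group gT})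
    (G : graph T) (P : {set {set T}}) (hG : in_calG to X G P) :
  let B := partition_seq G P in
  let Theta i := arc1_pairs G (B i.-1) in
  exists m : nat, unique (refinement_chain to X G P) m /\
  exists v k r b d : nat -> nat,
    (forall i, has_params G (B i) (v i) (k i) (r i) (b i) (d i)) /\
    [/\ (* (1) *)
        forall i, i < m ->
          [/\ in_calG to X G (B i), 2 <= v i & 1 <= k i <= (v i).-1],
        (* (2) *)
        forall i, i <= m ->
          [/\ v i.+1 %| gcdn (v i) (k i),
              r i %| gcdn (r i.+1) (b i.+1),
              d i.+1 %| d i,
              v i * r i = b i * k i
            & has_valency G (r i * d i)],
        (* (3) *)
        forall i, i < m ->
          [/\ forall p, p \in Theta i.+1 ->
                double_star (quot G (B i)) (r i) p,
              self_paired (Theta i.+1),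
              rank_transitive to^* X (Theta i.+1),
              star_base to^* X (quot G (B i)) (r i)
            & graph_iso (quot G (B i.+1)) (double_star_graph (Theta i.+1))],
        (* (4) *)
        forall i j, i < j -> j <= m ->
          [/\ in_calG to^* X (quot G (B j)) (quot_partition (B i) (B j)),
              has_params (quot G (B j)) (quot_partition (B i) (B j))
                (v i %/ v j) (k i %/ v j) (r i) (b i) (b j %/ r i)
            & graph_iso (quot (quot G (B j)) (quot_partition (B i) (B j)))
                (quot G (B i))]
      & (* (5) *)
        [/\ v m = k m, k m = 1, ~ nontrivial_partition G (B m)
          & graph_iso G (double_star_graph (Theta m))]
        \/
        [/\ v m = k m, 2 <= k m, invariant_partition to X G (B m),
            nontrivial_partition G (B m) & multicover G (B m)]].
Proof.
case: hG => symG [invP edgeP] nontriv nmulti B Theta.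
have [[a [c ac]] _ _ _ _] := symG.
have invB i : invariant_partition to X G (B i) := (seq_invariant_edge symG invP edgeP i).1.
have edgeB i : has_edge (quot G (B i)) := (seq_invariant_edge symG invP edgeP i).2.
have refB := seq_refines symG invP edgeP.
have [m /eqP fixm minm] := ex_minnP (seq_stabilizes symG invP edgeP ac).
have nfix i : i < m -> B i <> B i.+1.
  by move=> lim fixi; move: lim; rewrite ltnNge minm //; apply/eqP.
have kv i : i < m -> par_k G (B i) a c < par_v (B i) a.
  by move=> /nfix; apply: (seq_k_lt_v symG invP edgeP ac).
have m0 : 0 < m.
  rewrite lt0n; apply/eqP => m0; apply: nmulti.
  apply/(multicover_vk symG invP edgeP ac).
    exact/(nontrivial_v symG invP edgeP ac).
  by apply/(next_fixP symG invP edgeP ac); rewrite m0 in fixm.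
have chain : refinement_chain to X G P m.
  split=> // i; last first.
    move=> lemi; have Em := seq_stationary fixm.
    by rewrite (Em i) // (Em i.+1) // leqW.
  by move=> lim; split; [exact: (seq_coarsens symG invP edgeP) | exact: nfix].
exists m; split; first by split=> // m'; apply: refinement_chain_uniq.
exists (fun i => par_v (B i) a), (fun i => par_k G (B i) a c),
  (fun i => par_r G (B i) a), (fun i => par_b G (B i) a), (fun i => par_d G (B i) a c).
split; first by move=> i; apply: (params_at symG (invB i) (edgeB i) ac).
split.
- move=> i lim; have kvi := kv i lim; have k0 := par_k_gt0 (invB i) ac.
  split; first exact: (seq_in_calG symG invP edgeP ac (nfix i lim)).
    exact: leq_ltn_trans k0 kvi.
  by rewrite k0 -ltnS prednK // (leq_ltn_trans _ kvi).
- move=> i _; have ref1 := refB i i.+1 (ltnSn i).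
  split.
  + rewrite dvdn_gcd (refine_v symG (invB i) (edgeB i) (invB i.+1) ref1 ac).
    by rewrite (refine_k symG (invB i) (edgeB i) (invB i.+1) ref1 ac) !dvdn_mull.
  + rewrite dvdn_gcd (dvd_r symG (invB i) (edgeB i) (invB i.+1) ref1 ac).
    by rewrite (refine_d symG (invB i) (edgeB i) (invB i.+1) ref1 ac) dvdn_mulr.
  + exact: (dvd_d symG (invB i) (invB i.+1) ref1 ac).
  + exact: (count_vr_bk symG (invB i) (edgeB i) ac).
  exact: (valency_rd symG (invB i) (edgeB i) ac).
- move=> i lim; rewrite /Theta /=; split.
  + by move=> p; apply: (arc1_double_star symG (invB i) (edgeB i) ac).
  + exact: arc1_self_paired.
  + exact: arc1_rank_transitive symG (invB i).
  + exact: (arc1_star_base symG (invB i) (edgeB i) ac (kv i lim)).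
  exact: (next_iso symG (invB i) (edgeB i)).
- move=> i j ltij lejm; have refij := refB i j ltij.
  have ltim := leq_trans ltij lejm; split.
  + exact: (quot_in_calG symG (invB i) (edgeB i) (invB j) refij ac (kv i ltim)).
  + exact: (quot_params symG (invB i) (edgeB i) (invB j) refij ac).
  exact: (quot_iso symG (invB i) (edgeB i) (invB j) refij).
have vk : par_v (B m) a = par_k G (B m) a c.
  exact/(next_fixP symG (invB m) (edgeB m) ac)/esym.
have := par_k_gt0 (invB m) ac; rewrite leq_eqVlt => /predU1P[k1 | k2]; [left | right].
  split=> //.
    by move/(nontrivial_v symG (invB m) (edgeB m) ac); rewrite vk -k1.
  rewrite /Theta; apply: (discrete_next_iso symG (invB m.-1) (edgeB m.-1)).
  move=> x xV.
  have -> : next_partition G (B m.-1) = B m by rewrite -[in RHS](prednK m0).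
  by rewrite (par_v_const symG (invB m) (edgeB m) ac xV) vk -k1.
split=> //; first by apply/(nontrivial_v symG (invB m) (edgeB m) ac); rewrite vk.
by apply/(multicover_vk symG (invB m) (edgeB m) ac); rewrite ?vk.
Qed.
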